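(* Let $\mathscr{A}\subseteq\mathbb{N}$ be an OR$_+$ sequence. Then in the probability space $\mathcal{S}_{\mathscr{A}}$, with random sequence $\omega$, $$\mathbb{E}(r_{\omega,h}(n))=\Theta\left(\frac{A(n)^h}{n}\right)\quad\text{for every integer }h\geq 1.$$
   Context: $\mathbb{N}$ includes $0$. A sequence $\mathscr{A}=\{a_0<a_1<\cdots\}$ is an infinite subset of $\mathbb{N}$, with counting function $A(x)=|\mathscr{A}\cap[0,x]|$. $\mathscr{A}$ is OR$_+$ if $A(2x)=O(A(x))$ and $a_{2n}=O(a_n)$. For an OR$_+$ sequence $\mathscr{A}$, $\mathcal{S}_{\mathscr{A}}$ is the probability space on the set of infinite subsets $\omega\subseteq\mathbb{N}$, with $\sigma$-algebra generated by the events $\{n\in\omega\}$ ($n\in\mathbb{N}$), in which these events are mutually independent with $\Pr(n\in\omega)=\frac{A(n)}{n+1}$. $r_{\omega,h}(n)$ is the number of ordered $h$-tuples $(k_1,\dots,k_h)\in\omega^h$ with $k_1+\cdots+k_h=n$. Asymptotics are as $n\to+\infty$; $f=\Theta(g)$ means $f=O(g)$ and $g=O(f)$. *)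

(* Defs.v *)
From HB Require Import structures.
From mathcomp Require Import all_boot all_order all_algebra.
From mathcomp Require Import finmap.
From mathcomp Require Import all_classical all_reals all_analysis.

Set Implicit Arguments.
Unset Strict Implicit.
Unset Printing Implicit Defensive.

Import Order.TTheory GRing.Theory Num.Theory.
Import numFieldNormedType.Exports.

Local Open Scope classical_set_scope.
Local Open Scope ring_scope.

(* [A] is a function of a real variable, as in [A(2x) = O(A(x))]. The set
   counted is finite (R is archimedean), so the default value of [fset_set] on
   infinite sets is never used. *)
Definition count_upto (R : realType) (A : set nat) (x : R) : nat :=
  #|` fset_set (A `&` [set k | k%:R <= x]) |.

Definition enumerates (a : nat -> nat) (A : set nat) : Prop :=
  {homo a : m n / (m < n)%N} /\ range a = A.

(* Lets Landau notations be used at [+oo] in [R]. *)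
Canonical pinfty_filter_on (R : realType) : filter_on R :=
  FilterType (pinfty_nbhs R) _.

(* The increasing enumeration of an infinite set of naturals exists and is
   unique, so [exists a] could equivalently be [forall a]. *)
Definition OR_plus (R : realType) (A : set nat) : Prop :=
  [/\ infinite_set A,
      (fun x : R => (count_upto A (2 * x))%:R : R) =O_ (pinfty_nbhs R)
        (fun x : R => (count_upto A x)%:R : R)
    & exists a : nat -> nat, enumerates a A /\
        (fun n => (a (2 * n)%N)%:R : R) =O_\oo (fun n => (a n)%:R : R)].

Definition bigTheta_seq (R : realType) (f g : nat -> R) : Prop :=
  f =O_\oo g /\ g =O_\oo f.

Definition infinite_subset : Type := {w : set nat | infinite_set w}.

HB.instance Definition _ := gen_eqMixin infinite_subset.
HB.instance Definition _ := gen_choiceMixin infinite_subset.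
HB.instance Definition _ :=
  isPointed.Build infinite_subset (exist _ setT infinite_nat).

Definition contains (n : nat) : set infinite_subset :=
  [set w | sval w n].

Notation seq_space := (g_sigma_algebraType (range contains)).

Definition mutually_independent d (T : measurableType d) (R : realType)
    (P : probability T R) (I : choiceType) (E : I -> set T) : Prop :=
  forall J : {fset I},
    P (\bigcap_(i in [set` J]) E i) = (\prod_(i <- J) P (E i))%E.

(* These conditions determine [P], since finite intersections of the events
   [contains n] form a pi-system generating the sigma-algebra. *)
Definition is_S (R : realType) (A : set nat) (P : probability seq_space R) :
    Prop :=
  mutually_independent P (contains : nat -> set seq_space) /\
  forall n : nat,
    P (contains n) = ((count_upto A (n%:R : R))%:R / n.+1%:R)%:E.

(* A finite set of tuples, since all their entries are at most [n]. *)
Definition rep_count (w : seq_space) (h n : nat) : nat :=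
  #|` fset_set [set k : h.-tuple nat |
        (forall i, sval w (tnth k i)) /\ (\sum_(i < h) tnth k i)%N = n] |.

(* Main.v *)
(** The expectation is the sum, over the h-tuples [k] with sum [n], of the product
    of [p_v = A(v)/(v+1)] over the distinct values [v] of [k].

    Upper bound: the largest entry [m] of [k] is at least [n/h], so its factor is at
    most [h A(n)/n].  Deleting one occurrence of [m] and masking the others loses
    nothing but the position of [m], since [m] is then determined by the sum; the
    remaining entries are free and contribute [O(1 + sum_(v <= n) p_v)^(h-1)].
    The sum of the [p_v] is [O(A(n))]: the condition [a_(2n) = O(a_n)] gives an [M]
    with [A(Mx) >= 3/2 A(x)], so that [sum_(v <= n) p_v] is dominated by its part
    over [n/M < v <= n], which is at most [M A(n)].

    Lower bound: the tuples whose entries are all at least [L = n/(2h)] number at least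
    [L^(h-1)], each has weight at least [(A(L)/(n+1))^h], and [A(L)] is of the order
    of [A(n)] since [A(2x) = O(A(x))]. *)

Require Import Defs.
From mathcomp Require Import all_boot all_order all_algebra finmap.
From mathcomp Require Import all_classical all_reals all_analysis.
From mathcomp Require Import measurable_realfun.
From mathcomp Require Import zify ring lra.

Set Implicit Arguments.
Unset Strict Implicit.
Unset Printing Implicit Defensive.

Import Order.TTheory GRing.Theory Num.Theory.
Import numFieldNormedType.Exports.
Local Open Scope classical_set_scope.
Local Open Scope ring_scope.

(** * Weights of tuples as products over distinct entries *)

Lemma big_option (V : Type) (idx : V) (op : Monoid.com_law idx) (T : finType)
    (Q : pred (option T)) (F : option T -> V) :
  \big[op/idx]_(o | Q o) F o =
  op (if Q None then F None else idx) (\big[op/idx]_(v | Q (Some v)) F (Some v)).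
Proof.
rewrite big_mkcond (bigD1 None) //=; congr (op _ _).
rewrite (reindex_omap Some id) => [|[v|]] //=.
by rewrite [RHS]big_mkcond; apply: eq_bigl => v; rewrite eqxx.
Qed.

Section Weights.
Variables (R : numDomainType) (T : finType) (q : T -> R).
Hypothesis q_ge0 : forall v, 0 <= q v.

(** Distinct values only, because a repeated entry asks for the same event again. With [q] the
    membership probabilities, this is the probability that a random set contains every entry of
    [s]. *)
Definition wt (s : seq T) : R := \prod_(v | v \in s) q v.

Lemma wt_ge0 s : 0 <= wt s.
Proof. by apply: prodr_ge0. Qed.

(** A value already in [s] leaves the weight unchanged and a new one multiplies it by [q v]; adding
    both cases gives a bound that sums easily over [v]. *)
Lemma wt_cons_le v s : wt (v :: s) <= (v \in s)%:R * wt s + q v * wt s.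
Proof.
have [vs|vs] := boolP (v \in s).
  rewrite mul1r; suff -> : wt (v :: s) = wt s by rewrite lerDl mulr_ge0 ?wt_ge0.
  by apply: eq_bigl => u; rewrite inE; have [->|] := eqVneq u v.
rewrite mul0r add0r [leLHS](bigD1 v) ?mem_head //=.
rewrite (eq_bigl [in s]) // => u; rewrite inE.
by have [->|_] := eqVneq u v; rewrite /= ?andbT ?(negPf vs).
Qed.

(** Induction on the length: summing over one more entry costs at most a factor [m + \sum_v q v],
    since at most [m] values can repeat an earlier entry. *)
Lemma sum_wt_tuple (m j : nat) : (j <= m)%N ->
  \sum_(t : j.-tuple T) wt t <= (m%:R + \sum_v q v) ^+ j.
Proof.
have c_ge0 : 0 <= m%:R + \sum_v q v by rewrite addr_ge0 ?sumr_ge0.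
elim: j => [_|j IHj ltjm].
  rewrite (bigD1 [tuple]) //= big1 => [|t]; last by rewrite (tuple0 t) => /eqP.
  by rewrite addr0 /wt big_pred0.
rewrite (reindex (fun x : T * j.-tuple T => cons_tuple x.1 x.2)) /=; last first.
  exists (fun t : j.+1.-tuple T => (thead t, behead_tuple t)) => [[v t] _|t _].
    by congr pair => //; apply: val_inj.
  by case: (tupleP t) => v s; apply: val_inj.
rewrite -(pair_bigA _ (fun v (t : j.-tuple T) => wt (v :: t))) exchange_big /=.
apply: (@le_trans _ _ (\sum_(t : j.-tuple T) (m%:R + \sum_v q v) * wt t)).
  apply: ler_sum => t _; rewrite mulrDl.
  apply: le_trans (ler_sum _ (fun v _ => wt_cons_le v t)) _.
  rewrite big_split /= -!mulr_suml lerD2r ler_wpM2r ?wt_ge0 //.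
  rewrite -natr_sum ler_nat (leq_trans _ (ltnW ltjm)) //.
  rewrite -[leqRHS](size_tuple t); apply: leq_trans (card_size t).
  rewrite -sum1_card [leqRHS]big_mkcond; apply: leq_sum => v _.
  by case: (v \in t).
by rewrite -mulr_sumr exprS ler_wpM2l // IHj // ltnW.
Qed.

(** There are at most [size s] distinct values, and since [d <= 1], having fewer factors only
    helps. *)
Lemma wt_ge_exp (d : R) (s : seq T) : 0 <= d <= 1 ->
  {in s, forall v, d <= q v} -> d ^+ size s <= wt s.
Proof.
move=> /andP[d0 d1] dq; apply: (@le_trans _ _ (\prod_(v | v \in s) d)).
  by rewrite prodr_const ler_wiXn2l ?d0 // card_size.
by apply: ler_prod => v vs; rewrite d0 dq.
Qed.

End Weights.

Lemma ler_sum_inj (R : numDomainType) (I J : finType) (Q : pred I)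
    (f : I -> J) (F : I -> R) (G : J -> R) :
  {in Q &, injective f} -> (forall i, Q i -> F i <= G (f i)) ->
  (forall j, 0 <= G j) -> \sum_(i | Q i) F i <= \sum_j G j.
Proof.
move=> f_inj FG G0; apply: le_trans (ler_sum _ FG) _.
rewrite -(big_imset _ f_inj) /= [leRHS](bigID (mem (f @: Q))) /=.
by rewrite lerDl sumr_ge0.
Qed.

(** * Bounds for the weighted sum over representations of n *)

Section Representations.
Variables (R : numFieldType) (p : nat -> R) (h n : nat).
Hypothesis p_ge0 : forall m, 0 <= p m.

Local Notation wp := (wt (fun v : 'I_n.+1 => p v)).

Definition mean_rep : R :=
  \sum_(k : h.+1.-tuple 'I_n.+1 | (\sum_(i < h.+1) tnth k i)%N == n) wp k.

Implicit Type k : h.+1.-tuple 'I_n.+1.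

Let top k := [arg max_(i > ord0) (tnth k i : nat)]%N.
Let topv k := tnth k (top k).

Let le_topv k i : (tnth k i <= topv k)%N.
Proof. by rewrite /topv /top; case: arg_maxnP => // j _; apply. Qed.

(* [None] marks the remaining positions at which the maximum is attained, so
   that the maximum is recovered from the sum of the tuple. *)
Let rest k : h.-tuple (option 'I_n.+1) :=
  [tuple let v := tnth k (lift (top k) j) in if v == topv k then None else Some v
  | j < h].

(** [None] weighs 1 because the factor of the maximum is split off separately. *)
Let wq := wt (fun o : option 'I_n.+1 => if o is Some v then p v else 1).

Let restE k j : odflt (topv k) (tnth (rest k) j) = tnth k (lift (top k) j).
Proof. by rewrite tnth_mktuple /=; case: ifP => // /eqP ->. Qed.

Let sum_topv k : (\sum_(i < h.+1) tnth k i =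
  topv k + \sum_(j < h) odflt (topv k) (tnth (rest k) j))%N.
Proof.
rewrite (bigD1_ord (top k)) //=; congr (_ + _)%N.
by apply: eq_bigr => j _; rewrite restE.
Qed.

(** For a fixed masked rest, the sum is strictly increasing in the top value; its being [n] thus
    determines that value, and then every masked entry. *)
Let top_rest_inj : {in [pred k : h.+1.-tuple 'I_n.+1 |
    (\sum_(i < h.+1) tnth k i)%N == n] &,
  injective (fun k => (top k, rest k))}.
Proof.
move=> k k' /eqP sk /eqP sk' e.
have et : top k = top k' := congr1 fst e.
have er : rest k = rest k' := congr1 snd e.
have ev : topv k = topv k'.
  move: sk' sk; rewrite !sum_topv er => sk' sk.
  have mono (x y : 'I_n.+1) : (x <= y)%N ->
      (\sum_(j < h) odflt x (tnth (rest k') j) <=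
       \sum_(j < h) odflt y (tnth (rest k') j))%N.
    by move=> xy; apply: leq_sum => j _; case: (tnth _ _).
  apply: val_inj => /=; apply/eqP; rewrite eqn_leq.
  apply/andP; split; rewrite leqNgt; apply/negP => lt;
    have := mono _ _ (ltnW lt); lia.
apply: eq_from_tnth => i.
case: (unliftP (top k) i) => [j ->|->].
  by rewrite -restE [in RHS]et -restE er ev.
by rewrite -/(topv k) ev /topv et.
Qed.

Let wt_rest k : wp k = p (topv k) * wq (rest k).
Proof.
rewrite {1}/wt (bigD1 (topv k)) ?mem_tnth //=; congr (_ * _).
rewrite /wq /wt big_option /= if_same mul1r; apply: eq_bigl => v.
apply/andP/idP => [[/tnthP[i ->]]|/(tnthP (rest k))[j]].
  case: (unliftP (top k) i) => [j ->|->]; last by rewrite eqxx.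
  move=> /negPf ne; apply/(tnthP (rest k)); exists j.
  by rewrite tnth_mktuple /= ne.
by rewrite tnth_mktuple /=; case: ifP => // /negbT ne [->]; rewrite mem_tnth.
Qed.

Lemma mean_rep_le (B : R) :
    (forall m, (n <= h.+1 * m)%N -> (m <= n)%N -> p m <= B) ->
  mean_rep <= h.+1%:R * B * (h.+1%:R + \sum_(m < n.+1) p m) ^+ h.
Proof.
move=> pB.
have q0 (o : option 'I_n.+1) : 0 <= if o is Some v then p v else 1.
  by case: o.
have B0 : 0 <= B by apply: le_trans (p_ge0 n) (pB _ _ _) => //; lia.
rewrite /mean_rep.
apply: (@le_trans _ _
   (\sum_(x : 'I_h.+1 * h.-tuple (option 'I_n.+1)) B * wq x.2)).
  apply: (ler_sum_inj top_rest_inj) => [k /eqP sk|x].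
    rewrite wt_rest ler_wpM2r ?wt_ge0 //; apply: pB; last by rewrite -ltnS.
    rewrite -[leqLHS]sk -[X in (_ <= X * _)%N]card_ord -sum_nat_const.
    exact: leq_sum.
  by rewrite mulr_ge0 ?wt_ge0.
rewrite -(pair_bigA _ (fun=> fun t : h.-tuple _ => B * wq t)) /=.
rewrite sumr_const card_ord -[leLHS]mulr_natl -mulrA ler_wpM2l // -mulr_sumr.
rewrite ler_wpM2l //; apply: le_trans (sum_wt_tuple q0 (leqnn h)) _.
(* The weight 1 of [None] turns [h] into [h.+1]. *)
by rewrite big_option /= addrA natr1.
Qed.

Lemma mean_rep_ge (L : nat) (d : R) : 0 <= d <= 1 ->
    (2 * h.+1 * L <= n)%N ->
    (forall m, (L <= m)%N -> (m <= n)%N -> d <= p m) ->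
  L%:R ^+ h * d ^+ h.+1 <= mean_rep.
Proof.
move=> d01 hL dp.
(* The last [h] entries range freely over [[L, 2L)]; the first takes what remains, at least
   [n - 2hL >= 2L]. *)
pose u_sum (u : h.-tuple 'I_L) := (\sum_(j < h) (tnth u j + L))%N.
have u_le u : (u_sum u <= h * (2 * L))%N.
  rewrite -[X in (_ <= X * _)%N]card_ord -sum_nat_const.
  by apply: leq_sum => j _; have := ltn_ord (tnth u j); lia.
pose f (u : h.-tuple 'I_L) : h.+1.-tuple 'I_n.+1 :=
  cons_tuple (inord (n - u_sum u)) (map_tuple (fun x : 'I_L => inord (x + L)) u).
have fS u j : tnth (f u) (lift ord0 j) = (tnth u j + L)%N :> nat.
  rewrite tnthS tnth_map inordK //.
  by have := ltn_ord (tnth u j); nia.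
have f0 u : tnth (f u) ord0 = (n - u_sum u)%N :> nat.
  by rewrite tnth0 inordK // ltnS leq_subr.
have f_inj : injective f.
  move=> u u' e; apply: eq_from_tnth => j; apply: val_inj => /=.
  by apply: (@addIn L); rewrite -!fS e.
rewrite /mean_rep; apply: (@le_trans _ _ (\sum_(k in f @: predT) d ^+ h.+1)).
  by rewrite sumr_const card_imset // (card_tuple h 'I_L) card_ord -natrX mulr_natl.
rewrite [leRHS](bigID (mem (f @: predT))) /=.
apply: ler_wpDr; first by apply: sumr_ge0 => k _; rewrite wt_ge0.
rewrite [leRHS](eq_bigl [in f @: predT]) => [|k]; last first.
  apply/andP/idP => [[]//|kf]; split=> //; case/imsetP: kf => u _ ->.
  rewrite big_ord_recl f0; under eq_bigr do rewrite fS.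
  by rewrite -/(u_sum u) subnK //; have := u_le u; nia.
apply: ler_sum => k /imsetP[u _ ->].
rewrite -{1}(size_tuple (f u)) wt_ge_exp // => v /tnthP[i ->].
apply: dp; last by rewrite -ltnS.
case: (unliftP ord0 i) => [j ->|->]; first by rewrite fS leq_addl.
by rewrite f0; have := u_le u; nia.
Qed.

End Representations.

(** * The expectation as a sum of weights *)

Definition all_contained (h n : nat) (k : h.-tuple 'I_n.+1) : set seq_space :=
  [set w : seq_space | forall i, sval w (tnth k i : nat)].

(** Independence concerns finite sets of indices, so repeated entries are first merged. *)
Lemma all_containedE (h n : nat) (k : h.-tuple 'I_n.+1) :
  all_contained k =
  \bigcap_(m in [set` [fset val v | v in tval k]%fset])
    (contains m : set seq_space).
Proof.
apply/seteqP; split=> w /= wk => [m /= /imfsetP[v /= /tnthP[i ->] ->]|i].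
  exact: wk.
apply: (wk (tnth k i : nat)); apply/imfsetP.
by exists (tnth k i); rewrite ?mem_tnth.
Qed.

Lemma measurable_contains (m : nat) : measurable (contains m : set seq_space).
Proof. by apply: sub_sigma_algebra; exists m. Qed.

Lemma measurable_all_contained (h n : nat) (k : h.-tuple 'I_n.+1) :
  measurable (all_contained k).
Proof.
rewrite all_containedE; apply: fin_bigcap_measurable => [|m _].
  exact: finite_fset.
exact: measurable_contains.
Qed.

Lemma prob_all_contained (R : realType) (P : probability seq_space R)
    (p : nat -> R) (h n : nat) (k : h.-tuple 'I_n.+1) :
    mutually_independent P (contains : nat -> set seq_space) ->
    (forall m, P (contains m) = (p m)%:E) ->
  P (all_contained k) = (wt (fun v : 'I_n.+1 => p v) k)%:E.
Proof.
move=> indep Pp; rewrite all_containedE indep.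
under eq_bigr do rewrite Pp.
rewrite prodEFin; congr (_%:E).
rewrite /wt -big_enum -[RHS](big_map val xpredT p) /=.
apply: perm_big; apply: uniq_perm; rewrite ?fset_uniq //.
  by rewrite map_inj_uniq ?enum_uniq //; exact: val_inj.
move=> m; apply/imfsetP/mapP => -[v /= vk ->]; exists v => //.
  by rewrite mem_enum.
by rewrite mem_enum in vk.
Qed.

(** No entry of a representation exceeds [n], so the count is a finite sum of indicators, to which
    linearity of expectation applies. *)
Lemma rep_count_indic (R : realType) (w : seq_space) (h n : nat) :
  (rep_count w h n)%:R =
  \sum_(k : h.-tuple 'I_n.+1 | (\sum_(i < h) tnth k i)%N == n)
    \1_(all_contained k) w :> R.
Proof.
pose s := [seq k : h.-tuple 'I_n.+1 <- enum {: h.-tuple 'I_n.+1} |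
  ((\sum_(i < h) tnth k i)%N == n) && (w \in all_contained k)].
rewrite /rep_count (_ : [set _ | _] =
    [set` [fset map_tuple val k | k in s]%fset]); last first.
  apply/seteqP; split=> [t /= [tw st]|_ /= /imfsetP[k /= + ->]].
    have tn i : (tnth t i <= n)%N.
      by rewrite -st (bigD1 i) //= leq_addr.
    have tE : t = map_tuple val (map_tuple (fun x => inord x : 'I_n.+1) t).
      by apply: eq_from_tnth => i; rewrite !tnth_map /= inordK // ltnS.
    apply/imfsetP; exists (map_tuple (fun x => inord x : 'I_n.+1) t) => //=.
    rewrite mem_filter mem_enum andbT; apply/andP; split.
      rewrite -[X in _ == X]st; apply/eqP/eq_bigr => i _.
      by rewrite tnth_map inordK // ltnS.
    by apply/mem_set => i; rewrite tnth_map inordK ?ltnS.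
  rewrite mem_filter => /andP[/andP[/eqP sk /set_mem wk] _]; split=> [i|].
    by rewrite tnth_map; exact: wk.
  by rewrite -[RHS]sk; apply: eq_bigr => i _; rewrite tnth_map.
rewrite set_fsetK card_imfset /=; last first.
  by move=> k k' /(congr1 val) /= /(inj_map val_inj) e; apply: val_inj.
rewrite undup_id; last by rewrite filter_uniq ?enum_uniq.
rewrite -sum1_size natr_sum big_filter big_enum_cond /= big_mkcondr.
by apply: eq_bigr => k _; rewrite indicE; case: (w \in _).
Qed.

Lemma expectation_rep_count (R : realType) (P : probability seq_space R)
    (p : nat -> R) (h n : nat) :
    mutually_independent P (contains : nat -> set seq_space) ->
    (forall m, P (contains m) = (p m)%:E) ->
  fine 'E_P[fun w => (rep_count w h.+1 n)%:R] = mean_rep p h n.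
Proof.
move=> indep Pp; rewrite unlock.
under eq_integral do rewrite rep_count_indic -sumEFin -big_filter.
rewrite ge0_integral_sum //.
- rewrite big_filter -[RHS]/(fine (_%:E)) /mean_rep -sumEFin; congr fine.
  apply: eq_bigr => k _.
  rewrite integral_indic ?setIT //; last exact: measurable_all_contained.
  exact: prob_all_contained.
- move=> k; apply/measurable_EFinP/measurable_indic.
  exact: measurable_all_contained.
Qed.

(** * Growth of the counting function *)

Lemma enumerates_count_upto (R : realType) (A : set nat) (a : nat -> nat)
    (i n : nat) : enumerates a A ->
  (a i <= n)%N = (i < count_upto A (n%:R : R))%N.
Proof.
move=> [a_mono aA].
have a_inj : injective a.
  by move=> j k e; case: (ltngtP j k) => // /a_mono; rewrite e ltnn.
rewrite /count_upto.
have -> : [set k | k%:R <= n%:R :> R] = `I_n.+1.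
  by apply/seteqP; split=> k /=; rewrite ler_nat ltnS.
have finS : finite_set (A `&` `I_n.+1) by apply: finite_setIr; exact: finite_II.
(* If [a i <= n], then [a 0, ..., a i] are [i + 1] members up to [n]; otherwise all members up to
   [n] are among the first [i] terms. *)
apply/idP/idP => [ain|]; last rewrite ltnNge; last apply: contraNT.
  apply: leq_card_fset_set => //.
  apply: (@card_le_trans _ _ _ (a @` `I_i.+1)).
    by rewrite (card_le_eqr (inj_card_eq (in2W a_inj))).
  apply: subset_card_le => _ [j /= ji <-]; split; first by rewrite -aA; exists j.
  rewrite /= ltnS (leq_trans _ ain) //.
  by move: ji; rewrite ltnS leq_eqVlt => /predU1P[->//|/a_mono/ltnW].
rewrite -ltnNge => nai; apply: geq_card_fset_set.
apply: (@card_le_trans _ _ _ (a @` `I_i)); last exact: card_image_le.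
apply: subset_card_le => k [Ak /= kn]; move: Ak kn; rewrite -aA => -[j _ <-] ajn.
exists j => //=; rewrite ltnNge; apply/negP.
rewrite leq_eqVlt => /predU1P[e|/a_mono]; last by lia.
by move: nai ajn; rewrite e; lia.
Qed.

Section Counting.
Variables (a c : nat -> nat).
Hypothesis a_ge : forall i, (i <= a i)%N.
Hypothesis a_le : forall i n, (a i <= n)%N = (i < c n)%N.

Lemma counting_homo m n : (m <= n)%N -> (c m <= c n)%N.
Proof.
case e : (c m) => [//|j] mn; rewrite -a_le.
by apply: leq_trans mn; rewrite a_le e.
Qed.

Lemma counting_le n : (c n <= n.+1)%N.
Proof. by rewrite leqNgt -a_le -ltnNge a_ge. Qed.

Lemma counting_ratio_le1 (R : numFieldType) n : (c n)%:R / n.+1%:R <= 1 :> R.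
Proof. by rewrite ler_pdivrMr ?ltr0n // mul1r ler_nat counting_le. Qed.

(** With [c m = j + 1], [a (2j) <= M * a j <= M * m] gives [c (M * m) >= 2j + 1], and
    [3(j + 1) <= 2(2j + 1)] because [j >= 1]. *)
Lemma counting_dilate (M j0 m : nat) :
    (forall j, (j0 <= j)%N -> (a (2 * j) <= M * a j)%N) ->
    (j0.+2 <= c m)%N ->
  (3 * c m <= 2 * c (M * m))%N.
Proof.
move=> aM; case e : (c m) => [//|j] jj.
have : (a (2 * j) <= M * m)%N.
  by apply: leq_trans (aM _ _) _; rewrite ?leq_mul2l ?a_le ?e ?ltnSn ?orbT //; lia.
by rewrite a_le; lia.
Qed.

Lemma sum_counting_ratio (R : realFieldType) (M j0 : nat) : (1 < M)%N ->
    (forall j, (j0 <= j)%N -> (a (2 * j) <= M * a j)%N) ->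
  exists2 C : R, 0 <= C &
    forall n, \sum_(k < n.+1) (c k)%:R / k.+1%:R <= C * (c n)%:R.
Proof.
move=> M1 aM; pose x0 := a j0.+1.
(* With [C] this constant, the step from [n / M] to [n] needs [2/3 C + M <= C], hence [3 * M]; the
   other term bounds [n + 1] when [n / M < x0]. *)
exists (3 * M%:R + (M * x0.+1)%:R) => [|n]; first by rewrite addr_ge0 ?mulr_ge0.
elim/ltn_ind: n => n IHn.
have [c0|cn_gt0] := posnP (c n).
  rewrite big1 ?c0 ?mulr0 // => k _.
  have /counting_homo : (k <= n)%N by rewrite -ltnS.
  by rewrite c0 leqn0 => /eqP->; rewrite mul0r.
pose m := (n %/ M)%N.
have nM : (n < M * m.+1)%N by rewrite mulnC -ltn_divLR // ltnW.
have cn1 : 1 <= (c n)%:R :> R by rewrite ler1n.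
have [big_cm|small_cm] := leqP j0.+2 (c m); last first.
  apply: (@le_trans _ _ (\sum_(k < n.+1) (1 : R))).
    by apply: ler_sum => k _; exact: counting_ratio_le1.
  rewrite sumr_const card_ord.
  have mx : (m < x0)%N by rewrite ltnNge a_le -leqNgt.
  apply: (@le_trans _ _ (M * x0.+1)%:R); first by rewrite ler_nat; nia.
  rewrite -[leLHS]mulr1 ler_pM // lerDr mulr_ge0 //.
have mn : (m < n)%N.
  rewrite ltn_Pdiv //; case: n {IHn nM cn_gt0 cn1} @m big_cm => // m.
  by have := counting_le m; rewrite /m div0n; lia.
have := counting_dilate aM big_cm.
have : (c (M * m) <= c n)%N.
  by apply: counting_homo; rewrite mulnC leq_trunc_div.
move=> cMm cm.
have {cMm}cm : 3 * (c m)%:R <= 2 * (c n)%:R :> R.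
  by rewrite -!natrM ler_nat (leq_trans cm) // leq_mul2l cMm orbT.
rewrite -(big_mkord xpredT (fun k => (c k)%:R / k.+1%:R)).
rewrite (@big_cat_nat _ _ _ m.+1) //=; last by rewrite ltnS ltnW.
rewrite big_mkord.
(* At most [M * (m + 1)] terms, each at most [c n / (m + 1)]. *)
have tail : \sum_(m.+1 <= k < n.+1) (c k)%:R / k.+1%:R <= M%:R * (c n)%:R :> R.
  apply: (@le_trans _ _ (\sum_(m.+1 <= k < n.+1) ((c n)%:R / m.+1%:R : R))).
    apply: ler_sum_nat => k /andP[mk kn].
    rewrite ler_pM ?invr_ge0 // ?ler_nat ?counting_homo // lef_pV2 ?posrE ?ltr0n //.
    by rewrite ler_nat ltnW.
  rewrite sumr_const_nat -[leLHS]mulr_natl mulrCA [leRHS]mulrC ler_wpM2l //.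
  by rewrite ler_pdivrMr ?ltr0n // -natrM ler_nat subSS; lia.
apply: le_trans (lerD (IHn _ mn) tail) _.
have M0 : 0 <= M%:R :> R by [].
have X0 : 0 <= (M * x0.+1)%:R :> R by [].
have cm0 : 0 <= (c m)%:R :> R by [].
have : (3 * M%:R + (M * x0.+1)%:R) * (3 * (c m)%:R) <=
       (3 * M%:R + (M * x0.+1)%:R) * (2 * (c n)%:R) :> R.
  by rewrite ler_wpM2l // addr_ge0 ?mulr_ge0.
nra.
Qed.

Lemma counting_doubling_iter (R : numDomainType) (K : R) (L0 m t : nat) :
    0 <= K ->
    (forall j, (L0 <= j)%N -> (c (2 * j))%:R <= K * (c j)%:R) ->
    (L0 <= m)%N ->
  (c (2 ^ t * m))%:R <= K ^+ t * (c m)%:R.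
Proof.
move=> K0 cK Lm; elim: t => [|t IHt]; first by rewrite expr0 mul1r mul1n.
rewrite expnS -mulnA exprS -mulrA; apply: le_trans (cK _ _) _.
  by rewrite (leq_trans Lm) // leq_pmull // expn_gt0.
by rewrite ler_wpM2l.
Qed.

End Counting.

(** * The two bounds for the mean with explicit constants *)

Section MeanOrder.
Variables (R : realFieldType) (a c : nat -> nat) (h : nat).
Hypothesis a_ge : forall i, (i <= a i)%N.
Hypothesis a_le : forall i n, (a i <= n)%N = (i < c n)%N.

Let p (k : nat) : R := (c k)%:R / k.+1%:R.

Let p_ge0 k : 0 <= p k. Proof. exact: divr_ge0. Qed.

Lemma mean_rep_upper (C : R) (n : nat) : 0 <= C -> (0 < n)%N -> (0 < c n)%N ->
    \sum_(k < n.+1) p k <= C * (c n)%:R ->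
  mean_rep p h n <=
  h.+1%:R ^+ 2 * (h.+1%:R + C) ^+ h * ((c n)%:R ^+ h.+1 / n%:R).
Proof.
move=> C0 n0 cn0 sumC.
have cn1 : 1 <= (c n)%:R :> R by rewrite ler1n.
have nR : 0 < n%:R :> R by rewrite ltr0n.
apply: le_trans (mean_rep_le (B := h.+1%:R * (c n)%:R / n%:R) p_ge0 _) _.
  move=> m nm mn; rewrite /p ler_pdivrMr ?ltr0n // mulrAC ler_pdivlMr //.
  rewrite -!natrM ler_nat mulnC mulnAC; apply: leq_mul.
    by rewrite (leq_trans nm) // leq_mul.
  exact: counting_homo a_le _ _ mn.
have s0 : 0 <= \sum_(k < n.+1) p k by apply: sumr_ge0.
have -> : h.+1%:R ^+ 2 * (h.+1%:R + C) ^+ h * ((c n)%:R ^+ h.+1 / n%:R) =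
    h.+1%:R * (h.+1%:R * (c n)%:R / n%:R) * ((h.+1%:R + C) * (c n)%:R) ^+ h.
  by rewrite exprMn [_%:R ^+ h.+1]exprS; field; rewrite gt_eqF.
rewrite ler_wpM2l ?mulr_ge0 ?invr_ge0 // lerXn2r ?nnegrE ?addr_ge0 ?mulr_ge0 //.
  by rewrite addr_ge0.
(* Since [1 <= c n], the additive [h.+1] is absorbed into a multiple of [c n]. *)
rewrite mulrDl lerD // -[leLHS]mulr1 ler_wpM2l //.
Qed.

Lemma mean_rep_lower (K : R) (L0 n : nat) : 0 <= K ->
    (forall j, (L0 <= j)%N -> (c (2 * j))%:R <= K * (c j)%:R) ->
    (2 * h.+1 * L0.+1 <= n)%N ->
  (c n)%:R ^+ h.+1 / n%:R <=
  K ^+ (4 * h.+1 * h.+1) * (4 * h.+1)%:R ^+ h * 2 ^+ h.+1 * mean_rep p h n.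
Proof.
move=> K0 cK hn; pose L := (n %/ (2 * h.+1))%N.
have hL : (L0.+1 <= L)%N by rewrite leq_divRL // mulnC.
have Ln : (2 * h.+1 * L <= n)%N by rewrite mulnC leq_trunc_div.
(* As [L >= 1], rounding down loses at most a factor 2. *)
have nL : (n <= 4 * h.+1 * L)%N.
  have : (n < L.+1 * (2 * h.+1))%N by rewrite -ltn_divLR.
  by nia.
have n0 : (0 < n)%N by lia.
have nR : 0 < n%:R :> R by rewrite ltr0n.
(* [n <= 4 * h.+1 * L <= 2 ^ (4 * h.+1) * L], so [4 * h.+1] doublings lead from [L] to at least
   [n]. *)
have cnL : (c n)%:R <= K ^+ (4 * h.+1) * (c L)%:R.
  apply: le_trans (counting_doubling_iter (m := L) (4 * h.+1) K0 cK _); last by lia.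
  rewrite ler_nat (counting_homo a_le) // (leq_trans nL) // leq_mul2r.
  by rewrite ltnW ?orbT // ltn_expl.
pose d : R := (c L)%:R / n.+1%:R.
have d01 : 0 <= d <= 1.
  rewrite divr_ge0 //= ler_pdivrMr ?ltr0n // mul1r ler_nat.
  by rewrite (leq_trans (counting_le a_ge a_le L)) // ltnS; nia.
have dp m : (L <= m)%N -> (m <= n)%N -> d <= p m.
  move=> Lm mn; rewrite ler_pM ?invr_ge0 ?ler_nat ?(counting_homo a_le) //.
  by rewrite lef_pV2 ?posrE ?ltr0n // ler_nat.
have := mean_rep_ge p_ge0 d01 Ln dp.
set S := mean_rep p h n => SL.
apply: (@le_trans _ _ (K ^+ (4 * h.+1 * h.+1) * (4 * h.+1)%:R ^+ h * 2 ^+ h.+1 *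
   (L%:R ^+ h * d ^+ h.+1))); last by rewrite ler_wpM2l ?mulr_ge0 ?exprn_ge0.
(* The powers of [K] turn [c L] into [c n], those of [4 * h.+1] turn [L] into [n], and those of 2
   pay for [n + 1 <= 2n]. *)
have -> : K ^+ (4 * h.+1 * h.+1) * (4 * h.+1)%:R ^+ h * 2 ^+ h.+1 *
    (L%:R ^+ h * d ^+ h.+1) =
    (K ^+ (4 * h.+1) * (c L)%:R) ^+ h.+1 *
    ((4 * h.+1 * L)%:R ^+ h * (2 / n.+1%:R) ^+ h.+1).
  by rewrite exprM /d [(_ * L)%:R]natrM !exprMn; ring.
apply: ler_pM; rewrite ?exprn_ge0 ?invr_ge0 //.
  by rewrite lerXn2r ?nnegrE ?mulr_ge0 ?exprn_ge0.
apply: (@le_trans _ _ (n%:R ^+ h * n%:R^-1 ^+ h.+1)).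
  by rewrite exprS mulrCA -exprMn divff ?gt_eqF // expr1n mulr1.
apply: ler_pM; rewrite ?exprn_ge0 ?invr_ge0 //.
  by rewrite lerXn2r ?nnegrE ?ler_nat.
rewrite lerXn2r ?nnegrE ?invr_ge0 ?divr_ge0 //.
rewrite ler_pdivlMr ?ltr0n // mulrC ler_pdivrMr // -natrM ler_nat; lia.
Qed.

End MeanOrder.

(** * From the Landau conditions to explicit constants and back *)

Theorem lemma4p2 (R : realType) (A : set nat) (hA : OR_plus R A)
    (P : probability seq_space R) (hP : is_S A P) (h : nat) (hh : (1 <= h)%N) :
  bigTheta_seq
    (fun n => fine 'E_P[fun w => (rep_count w h n)%:R])
    (fun n => (count_upto A (n%:R : R))%:R ^+ h / n%:R).
Proof.
case: h hh => // h _.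
case: hP => indep Pp.
case: hA => _ /eqO_exP[K K0 [X [_ XK]]] [a [ea /eqO_exP[M0 M00 [j0 _ aM0]]]].
pose c n := count_upto A (n%:R : R).
pose p (k : nat) : R := (c k)%:R / k.+1%:R.
have a_le i n : (a i <= n)%N = (i < c n)%N.
  exact: enumerates_count_upto ea.
have a_ge i : (i <= a i)%N.
  by elim: i => // i IHi; apply: leq_ltn_trans IHi _; apply: ea.1.
have cK j : (Num.bound `|X| <= j)%N -> (c (2 * j))%:R <= K * (c j)%:R.
  move=> Xj; have Xltj : X < j%:R.
    apply: le_lt_trans (ler_norm X) _.
    by apply: lt_le_trans (archi_boundP (normr_ge0 X)) _; rewrite ler_nat.
  by have := XK _ Xltj; rewrite !normr_nat /c natrM.
(* The [.+2] makes the factor exceed 1, so that dividing by it shrinks the argument in the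
   induction. *)
have aM j : (j0 <= j)%N -> (a (2 * j) <= (Num.bound M0).+2 * a j)%N.
  move=> /aM0; rewrite !normr_nat -(ler_nat R) natrM => /le_trans; apply.
  rewrite ler_wpM2r // ltW // (lt_le_trans (archi_boundP (ltW M00))) //.
  by rewrite ler_nat; lia.
have [C C0 sumC] := sum_counting_ratio a_ge a_le R (isT : 1 < _.+2)%N aM.
have -> : (fun n => fine 'E_P[fun w => (rep_count w h.+1 n)%:R]) = mean_rep p h.
  by apply/funext => n; exact: expectation_rep_count.
have mean_ge0 n : 0 <= mean_rep p h n.
  by apply: sumr_ge0 => k _; apply: wt_ge0 => v; exact: divr_ge0.
have rhs_ge0 n : 0 <= (c n)%:R ^+ h.+1 / n%:R :> R by rewrite divr_ge0 ?exprn_ge0.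
split; apply/eqO_exP.
- exists (h.+1%:R ^+ 2 * (h.+1%:R + C) ^+ h).
    by rewrite mulr_gt0 ?exprn_gt0 ?ltr0n // ltr_pwDl.
  (* Beyond [a 0], both [n] and [c n] are positive, which also avoids the default value of division
     by 0. *)
  exists (a 0).+1 => // n /= an; rewrite !ger0_norm //.
  have n_gt0 : (0 < n)%N by apply: leq_ltn_trans an.
  have cn_gt0 : (0 < c n)%N by rewrite -a_le ltnW.
  exact: (mean_rep_upper h a_le C0 n_gt0 cn_gt0 (sumC n)).
- exists (K ^+ (4 * h.+1 * h.+1) * (4 * h.+1)%:R ^+ h * 2 ^+ h.+1).
    by rewrite !mulr_gt0 ?exprn_gt0 ?ltr0n.
  exists (2 * h.+1 * (Num.bound `|X|).+1)%N => // n /= hn; rewrite !ger0_norm //.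
  exact: (mean_rep_lower a_ge a_le (ltW K0) cK hn).
Qed.
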